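(* Let $X$ be a set, let $h_i:X\to\mathbb{R}$, $i=1,\dots,r$, be arbitrarily fixed functions, and let $A(X)$ be a permissible function class on $X$ (with respect to $h_1,\dots,h_r$). If $A(X)\subset\mathcal{B}(h_1,\dots,h_r;X)$, then $\mathcal{B}(h_1,\dots,h_r;X)=T(X)$.
   Context: $T(X)$ is the set of all functions $X\to\mathbb{R}$, and $$\mathcal{B}(h_1,\dots,h_r;X)=\Big\{x\mapsto\sum_{i=1}^rg_i(h_i(x)):\ g_i:\mathbb{R}\to\mathbb{R},\ i=1,\dots,r\Big\}.$$ For $a\in\mathbb{R}$, $\chi_a$ is the characteristic function of $\{a\}\subset\mathbb{R}$. A finite set of (distinct) points $\{x_1,\dots,x_n\}\subset X$ is a cycle with respect to $h_1,\dots,h_r$ if there is a vector $\lambda=(\lambda_1,\dots,\lambda_n)$ with all coordinates nonzero real numbers such that $\sum_{j=1}^n\lambda_j\chi_{h_i(x_j)}=0$ for $i=1,\dots,r$. A cycle is minimal if it contains no cycle as a proper subset. For a minimal cycle $p=\{x_1,\dots,x_n\}$ the vector $\lambda$ is unique up to a constant factor, and $G_p(f)=\sum_{j=1}^n\lambda_jf(x_j)$ with the normalization $\sum_j|\lambda_j|=1$ (unique up to sign). A class $A(X)$ of real functions on $X$ is called a permissible function class if for every minimal cycle $p\subset X$ with respect to $h_1,\dots,h_r$ (if any exist) there is a function $f_0\in A(X)$ with $G_p(f_0)\neq0$. *)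

(* Defs.v *)
From HB Require Import structures.
From mathcomp Require Import all_boot all_order all_algebra.
From mathcomp Require Import boolp classical_sets functions reals numfun.

Set Implicit Arguments.
Unset Strict Implicit.
Unset Printing Implicit Defensive.

Import Order.TTheory GRing.Theory Num.Theory.
Local Open Scope classical_set_scope.
Local Open Scope ring_scope.

Section Superpositions.
Context {R : realType} {X : Type} {r : nat}.
Implicit Types (h : 'I_r -> X -> R) (p q : set X) (f : X -> R).

Definition superpositions h : set (X -> R) :=
  [set f | exists g : 'I_r -> R -> R, f = fun x => \sum_(i < r) g i (h i x)].

Definition cycle_vector h n (x : 'I_n -> X) (lambda : 'I_n -> R) : Prop :=
  (forall j, lambda j != 0) /\
  (forall (i : 'I_r) (t : R),
     \sum_(j < n) lambda j * (\1_[set h i (x j)] : R -> R) t = 0).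

(* Cycles are nonempty: for n = 0 the vanishing condition is vacuous, and an
   empty cycle would be the only minimal one. *)
Definition is_cycle h p : Prop :=
  exists (n : nat) (x : 'I_n -> X) (lambda : 'I_n -> R),
    [/\ (0 < n)%N, injective x, range x = p & cycle_vector h x lambda].

Definition minimal_cycle h p : Prop :=
  is_cycle h p /\ forall q, q `<` p -> ~ is_cycle h q.

Definition is_cycle_functional h p (G : (X -> R) -> R) : Prop :=
  exists (n : nat) (x : 'I_n -> X) (lambda : 'I_n -> R),
    [/\ injective x, range x = p, cycle_vector h x lambda,
        \sum_(j < n) `|lambda j| = 1
      & G = fun f => \sum_(j < n) lambda j * f (x j)].

(* For a minimal cycle p exactly two functionals, opposite to each other,
   satisfy is_cycle_functional h p; this picks one of them.  The default value
   0 is only used when p is not a cycle. *)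
Definition cycle_functional h p : (X -> R) -> R :=
  xget (fun=> 0) [set G | is_cycle_functional h p G].

Definition permissible h (A : set (X -> R)) : Prop :=
  forall p, minimal_cycle h p ->
    exists f0, A f0 /\ cycle_functional h p f0 != 0.

End Superpositions.

(* Main.v *)
Require Import Defs.
From HB Require Import structures.
From mathcomp Require Import all_boot all_order all_algebra.
From mathcomp Require Import boolp classical_sets functions reals numfun.

(* A cycle functional kills every superposition, so permissibility together
   with A `<=` superpositions h rules out minimal cycles; a cycle with the least
   number of points is minimal, hence there are no cycles at all.  Without
   cycles, the vectors [v x = sum_i delta_(i, h i x)] in the space of functions
   on ['I_r * R] are linearly independent, so by Zorn's lemma the assignment
   [v x |-> f x] extends to the whole space; the values of the extension at
   [delta_(i, t)] are the required [g i t]. *)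

Set Implicit Arguments.
Unset Strict Implicit.
Unset Printing Implicit Defensive.

Import Order.TTheory GRing.Theory Num.Theory.
Local Open Scope classical_set_scope.
Local Open Scope ring_scope.

Section Span.
Context {K : fieldType} {V : lmodType K}.
Implicit Types (G : set V) (u v : V).

Inductive span G : V -> Prop :=
| span0 : span G 0
| spanS c v u : G v -> span G u -> span G (c *: v + u).

Lemma sub_span G G' u : G `<=` G' -> span G u -> span G' u.
Proof.
move=> GG'; elim=> [|c v w Gv _ IHw]; first exact: span0.
by apply: spanS => //; exact: GG'.
Qed.

Lemma spanD G u v : span G u -> span G v -> span G (u + v).
Proof.
move=> + Gv; elim=> [|c w w' Gw _ IHw]; first by rewrite add0r.
by rewrite -addrA; exact: spanS.
Qed.

Lemma spanZ G c u : span G u -> span G (c *: u).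
Proof.
elim=> [|d v w Gv _ IHw]; first by rewrite scaler0; exact: span0.
by rewrite scalerDr scalerA; exact: spanS.
Qed.

Lemma mem_span G u : G u -> span G u.
Proof. by move=> Gu; rewrite -[u]scale1r -[_ *: u]addr0; apply/spanS/span0. Qed.

Lemma span_sum G (I : Type) (s : seq I) (F : I -> V) :
  (forall i, span G (F i)) -> span G (\sum_(i <- s) F i).
Proof. by move=> GF; elim/big_ind: _ => //; [exact: span0|exact: spanD]. Qed.

Lemma spanU1 G v u :
  span (G `|` [set v]) u -> exists c w, span G w /\ u = c *: v + w.
Proof.
elim=> [|c g w [Gg|->] _ [d [z [Gz ->]]]].
- by exists 0, 0; split; [exact: span0|rewrite scale0r addr0].
- by exists d, (c *: g + z); split; [exact: spanS|rewrite addrCA].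
- by exists (c + d), z; split=> //; rewrite scalerDl addrA.
Qed.

Lemma span_setU_bigcup G (F : set (set V)) u : total_on F subset ->
  span (G `|` \bigcup_(S in F) S) u ->
  span G u \/ exists2 S, F S & span (G `|` S) u.
Proof.
move=> Ftot; elim=> [|c g w Gg _ IHw]; first by left; exact: span0.
case: Gg => [Gg|[S FS Sg]].
- case: IHw => [Gw|[S FS Sw]]; first by left; exact: spanS.
  by right; exists S => //; apply: spanS => //; left.
- right; case: IHw => [Gw|[S' FS' Sw]].
    exists S => //; apply: spanS; first by right.
    by apply: sub_span Gw => x; left.
  have [SS'|S'S] := Ftot _ _ FS FS'.
    by exists S' => //; apply: spanS => //; right; exact: SS'.
  exists S => //; apply: spanS; first by right.
  by apply: sub_span Sw => x [|/S'S]; [left|right].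
Qed.

Lemma span_range (T : eqType) (w : T -> V) u : span (range w) u ->
  exists (s : seq T) (c : T -> K),
    [/\ uniq s, forall x, x \in s -> c x != 0 & u = \sum_(x <- s) c x *: w x].
Proof.
move=> wu; suff [s [c [su ->]]] : exists (s : seq T) (c : T -> K),
    uniq s /\ u = \sum_(x <- s) c x *: w x.
  exists [seq x <- s | c x != 0], c; split; first exact: filter_uniq.
    by move=> x; rewrite mem_filter => /andP[].
  rewrite big_filter [LHS](bigID (fun x => c x != 0)) /= [X in _ + X]big1 ?addr0//.
  by move=> x; rewrite negbK => /eqP ->; rewrite scale0r.
elim: wu => [|d _ z [x _ <-] _ [s [c [su ->]]]].
  by exists [::], (fun=> 0); rewrite big_nil.
have [xs|xs] := boolP (x \in s).
  exists s, (fun y => if y == x then d + c x else c y); split=> //.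
  rewrite [in RHS](bigD1_seq x)//= (bigD1_seq x)//= eqxx scalerDl -addrA.
  by congr (_ + (_ + _)); apply: eq_bigr => y /negPf ->.
exists (x :: s), (fun y => if y == x then d else c y); split; first by rewrite /= xs.
rewrite big_cons eqxx; congr (_ + _); apply: eq_big_seq => y ys.
by case: eqP => // yx; rewrite -yx ys in xs.
Qed.

End Span.

(* A pair (v, a) prescribes the value a at v for a linear form on V. *)
Definition consistent (K : fieldType) (V : lmodType K) (G : set (V * K^o)) :=
  forall a, span G (0, a) -> a = 0.

Lemma consistent_total (K : fieldType) (V : lmodType K) (G : set (V * K^o)) :
  consistent G -> exists S : set (V * K^o),
    [/\ G `<=` S, consistent S & forall v, exists a, span S (v, a)].
Proof.
move=> cG; pose P (S : set (V * K^o)) := consistent (G `|` S).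
have [|S [PS Smax]] := @Zorn_bigcup _ P.
  move=> F FP Ftot a /(span_setU_bigcup Ftot)[/cG//|[S FS]].
  exact: (FP _ FS).
exists (G `|` S); split=> //.
move=> v; apply: contrapT => /forallNP vS.
apply: (Smax (S `|` [set (v, 0)])).
  split; first by move=> x; left.
  move=> /(_ (v, 0))Sv; apply: (vS 0); apply: mem_span; right; apply: Sv.
  by right.
move=> a; rewrite setUA => /spanU1[c [[w b] [Sw [vw ab]]]].
have [c0|c0] := eqVneq c 0.
  by move: vw ab; rewrite c0 !scale0r !add0r => w0 ->; apply: PS; rewrite w0.
exfalso; apply: (vS (- c^-1 *: b)).
have -> : v = - c^-1 *: w.
  apply: (scalerI c0); rewrite scalerA mulrN mulfV// scaleN1r.
  by apply/eqP; rewrite -addr_eq0 -vw.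
exact: (spanZ (- c^-1) Sw).
Qed.

Section Cycles.
Context {R : realType} {X : Type} {r : nat} (h : 'I_r -> X -> R).

Lemma cycle_vector_superpositions n (x : 'I_n -> X) (l : 'I_n -> R) f :
  cycle_vector h x l -> superpositions h f -> \sum_(j < n) l j * f (x j) = 0.
Proof.
move=> [_ l0] [g ->]; under eq_bigr do rewrite mulr_sumr.
rewrite exchange_big big1//= => i _.
pose s := undup [seq h i (x j) | j <- enum 'I_n].
transitivity (\sum_(j < n) \sum_(t <- s)
    g i t * (l j * (\1_[set h i (x j)] : R -> R) t)).
  apply: eq_bigr => j _; rewrite (bigD1_seq (h i (x j))) ?undup_uniq//=; last first.
    by rewrite mem_undup; apply: map_f; rewrite mem_enum.
  rewrite indicE mem_set// mulr1 mulrC big1 ?addr0// => t /eqP th.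
  by rewrite indicE memNset ?mulr0.
by rewrite exchange_big big1//= => t _; rewrite -mulr_sumr l0 mulr0.
Qed.

Lemma cycle_has_functional p :
  is_cycle h p -> exists G, is_cycle_functional h p G.
Proof.
move=> [n [x [l [n0 xinj xp [lN0 l0]]]]].
have N0 : 0 < \sum_(j < n) `|l j|.
  by rewrite (bigD1 (Ordinal n0))//= ltr_wpDr ?normr_gt0// sumr_ge0.
set N := \sum_(j < n) `|l j| in N0.
exists (fun f => \sum_(j < n) (N^-1 * l j) * f (x j)).
exists n, x, (fun j => N^-1 * l j); split=> //.
  split=> [j|i t]; first by rewrite mulf_neq0// invr_eq0 gt_eqF.
  by under eq_bigr do rewrite -mulrA; rewrite -mulr_sumr l0 mulr0.
under eq_bigr do rewrite normrM.
by rewrite -mulr_sumr gtr0_norm ?invr_gt0// mulVf// gt_eqF.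
Qed.

Lemma cycle_functional_superpositions p f :
  is_cycle h p -> superpositions h f -> cycle_functional h p f = 0.
Proof.
move=> /cycle_has_functional/(xgetPex (fun=> 0)).
move=> [n [x [l [_ _ cl _ G]]]]; rewrite /cycle_functional G => hf.
exact: cycle_vector_superpositions cl hf.
Qed.

Lemma proper_range_ltn m n (x : 'I_m -> X) (y : 'I_n -> X) :
  injective x -> injective y -> range x `<` range y -> (m < n)%N.
Proof.
move=> xinj yinj [xy yNx].
have /choice[s sE] : forall j, exists k, y k = x j.
  by move=> j; have [k _ <-] := xy _ (imageT x j); exists k.
have sinj : injective s by move=> j k jk; apply: xinj; rewrite -!sE jk.
have := leq_card s sinj; rewrite !card_ord leq_eqVlt => /orP[/eqP mn|//].
have [|s' _ s'K] := inj_card_bij sinj; first by rewrite !card_ord mn.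
by exfalso; apply: yNx => _ [k _ <-]; exists (s' k) => //; rewrite -sE s'K.
Qed.

Lemma cycle_minimal p : is_cycle h p -> exists q, minimal_cycle h q.
Proof.
pose P n := `[< exists (x : 'I_n -> X) (l : 'I_n -> R),
  [/\ (0 < n)%N, injective x & cycle_vector h x l] >].
move=> [n [x [l [n0 xinj _ cl]]]].
have exP : exists n, P n by exists n; apply/asboolP; exists x, l.
have [m /asboolP[y [c [m0 yinj cc]]] mmin] := ex_minnP exP.
exists (range y); split; first by exists m, y, c.
move=> q qy [k [z [d [k0 zinj zq cd]]]].
have : (k < m)%N by apply: (proper_range_ltn zinj yinj); rewrite zq.
by rewrite ltnNge mmin//; apply/asboolP; exists z, d.
Qed.

Let delta (p : 'I_r * R) : 'I_r * R -> R^o := fun q => (p == q)%:R.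
Let point_vector (x : X) := \sum_(i < r) delta (i, h i x).

Let point_vectorE x i t : point_vector x (i, t) = (\1_[set h i x] : R -> R) t.
Proof.
rewrite /point_vector fct_sumE (bigD1 i)//= big1 => [|j ji].
  rewrite addr0 /delta xpair_eqE eqxx /= indicE; congr ((nat_of_bool _)%:R).
  by rewrite eq_sym; apply/eqP/idP; rewrite inE.
by rewrite /delta xpair_eqE (negPf ji).
Qed.

Lemma acyclic_superpositions :
  (forall p, ~ is_cycle h p) -> superpositions h = [set: X -> R].
Proof.
move=> acyc; rewrite -subTset => f _.
pose w (x : {classic X}) := (point_vector x, f x : R^o).
have /consistent_total[S [wS cS tS]] : consistent (range w).
  move=> a /span_range[s [c [su cN0]]].
  have [/size0nil ->|s0] := posnP (size s); first by rewrite big_nil => -[].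
  rewrite big_tnth => /(congr1 fst) e1.
  exfalso; apply: (acyc (range (tnth (in_tuple s) : _ -> X))).
  exists (size s), (tnth (in_tuple s)), (c \o tnth (in_tuple s)); split=> //.
    exact: (elimT (tuple_uniqP (in_tuple s)) su).
  split=> [j|i t]; first by apply: cN0; exact: mem_tnth.
  move: e1; rewrite (raddf_sum fst) /= => /(congr1 (fun u => u (i, t))).
  rewrite fct_sumE => e1; rewrite [RHS]e1; apply: eq_bigr => j _.
  by rewrite -point_vectorE.
have /choice[g gE] : forall p, exists a, span S (delta p, a) by move=> p; exact: tS.
exists (fun i t => g (i, t)); apply/funext => x; apply/eqP; rewrite -subr_eq0.
apply/eqP/cS.
have -> : (0, f x - \sum_(i < r) g (i, h i x)) =
    w x + (-1) *: \sum_(i < r) (delta (i, h i x), g (i, h i x)).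
  rewrite /w; set u := \sum_(_ < _) (_, _).
  have u1 : u.1 = point_vector x by rewrite (raddf_sum fst).
  have u2 : u.2 = \sum_(i < r) g (i, h i x) by rewrite (raddf_sum snd).
  by rewrite [u]surjective_pairing u1 u2 scaleN1r; congr pair; rewrite /= subrr.
apply: spanD; first by apply/mem_span/wS; exists x.
by apply: spanZ; apply: span_sum => i; exact: gE.
Qed.

End Cycles.

Theorem theorem4p1 (R : realType) (X : Type) (r : nat) (h : 'I_r -> X -> R)
    (A : set (X -> R)) :
  permissible h A -> A `<=` superpositions h ->
  superpositions h = [set: X -> R].
Proof.
move=> permA Ah; apply: acyclic_superpositions => _ /cycle_minimal[p minp].
have [f [Af /eqP]] := permA p minp; apply.
by apply: cycle_functional_superpositions (Ah _ Af); case: minp.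
Qed.
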